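(* Let $n,k$ be integers with $n\ge 2k\ge 4$ and let $Y$ be a graph on $n$ vertices. If $Y$ is disconnected, or $Y$ is bipartite, or $Y$ contains a non-trivial $k$-bridge, or $Y$ is (isomorphic to) the cycle $C_n$, then the friends-and-strangers graph $\mathsf{FS}(K_{k,n-k},Y)$ is disconnected.
   Context: All graphs are finite and simple, without loops. $C_n$ is the cycle on $n$ vertices and $K_{k,n-k}$ is the complete bipartite graph with parts of sizes $k$ and $n-k$. Friends-and-strangers graph: for graphs $X,Y$ each with $n$ vertices, $\mathsf{FS}(X,Y)$ is the graph whose vertices are all bijections $\sigma:V(X)\to V(Y)$; two bijections $\sigma,\sigma'$ are adjacent if and only if there is an edge $ab\in E(X)$ such that $\sigma(a)\sigma(b)\in E(Y)$, $\sigma(a)=\sigma'(b)$, $\sigma(b)=\sigma'(a)$, and $\sigma(c)=\sigma'(c)$ for all $c\in V(X)\setminus\{a,b\}$. Non-trivial $k$-bridge ($k\ge 2$): a cut edge of a connected graph is an edge whose removal disconnects the graph; it is non-trivial if neither of its ends has degree one. If a path $P=v_1v_2\cdots v_k$ is obtained by subdividing $k-2$ times a non-trivial cut edge $v_1v_k$ of a connected graph, then $P$ is called a non-trivial $k$-bridge of the resulting graph. That is, a graph $Y$ contains a non-trivial $k$-bridge if $Y$ is obtained from some connected graph $H$ with a non-trivial cut edge $v_1v_k$ by replacing this edge with a path $v_1v_2\cdots v_k$ whose interior vertices $v_2,\dots,v_{k-1}$ are new vertices (having degree 2 in $Y$). A non-trivial $2$-bridge is just a non-trivial cut edge. *)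

(* Defs.v *)
From HB Require Import structures.
From mathcomp Require Import all_boot.

Set Implicit Arguments.
Unset Strict Implicit.
Unset Printing Implicit Defensive.

Record sgraph := SGraph {
  vertex :> finType;
  edge : rel vertex;
  edge_sym : symmetric edge;
  edge_irrefl : irreflexive edge }.

Definition connected (G : sgraph) : Prop :=
  forall x y : G, connect (@edge G) x y.

Definition bipartite (G : sgraph) : Prop :=
  exists c : G -> bool, forall x y : G, edge x y -> c x != c y.

Definition isomorphic (G H : sgraph) : Prop :=
  exists2 f : G -> H, bijective f & forall x y : G, edge (f x) (f y) = edge x y.

Definition degree (G : sgraph) (x : G) : nat := #|[set y : G | edge x y]|.

Section CompleteBipartite.
Variables p q : nat.

Definition Kpq_rel : rel ('I_p + 'I_q) := fun u v =>
  match u, v with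
  | inl _, inr _ | inr _, inl _ => true
  | _, _ => false
  end.

Lemma Kpq_sym : symmetric Kpq_rel. Proof. by case=> ? []. Qed.
Lemma Kpq_irrefl : irreflexive Kpq_rel. Proof. by case. Qed.

Definition complete_bipartite : sgraph := SGraph Kpq_sym Kpq_irrefl.

End CompleteBipartite.

Section Cycle.
Variable n : nat.

(* The conjunct [i != j] only matters for n = 1, where it removes the loop. *)
Definition cycle_rel : rel 'I_n := fun i j =>
  (i != j) && ((i.+1 %% n == j) || (j.+1 %% n == i)).

Lemma cycle_rel_sym : symmetric cycle_rel.
Proof. by move=> i j; rewrite /cycle_rel eq_sym orbC. Qed.
Lemma cycle_rel_irrefl : irreflexive cycle_rel.
Proof. by move=> i; rewrite /cycle_rel eqxx. Qed.

Definition cycle_graph : sgraph := SGraph cycle_rel_sym cycle_rel_irrefl.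

End Cycle.

Section EdgeOperations.
Variables (G : sgraph) (a b : G).

Definition del_edge_rel : rel G := fun x y =>
  edge x y && ([set x; y] != [set a; b]).

Lemma del_edge_sym : symmetric del_edge_rel.
Proof. by move=> x y; rewrite /del_edge_rel edge_sym setUC. Qed.
Lemma del_edge_irrefl : irreflexive del_edge_rel.
Proof. by move=> x; rewrite /del_edge_rel edge_irrefl. Qed.

Definition del_edge : sgraph := SGraph del_edge_sym del_edge_irrefl.

(* The edge ab is replaced by the path a, inr 0, ..., inr (m - 1), b,
   and is kept when m = 0. *)
Definition subdivide_rel (m : nat) : rel (G + 'I_m) := fun u v =>
  match u, v with
  | inl x, inl y => if m == 0 then edge x y else del_edge_rel x y
  | inl x, inr i | inr i, inl x =>
      ((x == a) && (i == 0 :> nat)) || ((x == b) && (i.+1 == m))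
  | inr i, inr j => (i.+1 == j) || (j.+1 == i)
  end.

Lemma subdivide_sym m : symmetric (@subdivide_rel m).
Proof.
by case=> [x|i] [y|j] //=; [rewrite edge_sym del_edge_sym | rewrite orbC].
Qed.
Lemma subdivide_irrefl m : irreflexive (@subdivide_rel m).
Proof.
case=> [x|i] /=; first by rewrite edge_irrefl del_edge_irrefl; case: ifP.
by rewrite orbb gtn_eqF.
Qed.

Definition subdivide (m : nat) : sgraph :=
  SGraph (@subdivide_sym m) (@subdivide_irrefl m).

End EdgeOperations.

Definition cut_edge (G : sgraph) (a b : G) : Prop :=
  edge a b /\ ~ connected (del_edge a b).

Definition nontrivial_cut_edge (G : sgraph) (a b : G) : Prop :=
  [/\ cut_edge a b, degree a <> 1 & degree b <> 1].

(* Intended for k >= 2; the subtraction is truncated. *)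
Definition has_nontrivial_bridge (k : nat) (Y : sgraph) : Prop :=
  exists (H : sgraph) (a b : H),
    [/\ connected H, nontrivial_cut_edge a b
      & isomorphic Y (subdivide a b (k - 2))].

Section FriendsAndStrangers.
Variables X Y : sgraph.

Definition bijectiveb (f : {ffun X -> Y}) : bool :=
  injectiveb f && [forall y, exists x, f x == y].

Definition bijection : finType := {f : {ffun X -> Y} | bijectiveb f}.

Definition FS_rel : rel bijection := fun s t =>
  [exists a : X, exists b : X,
    [&& edge a b, edge (val s a) (val s b),
        val s a == val t b, val s b == val t a
      & [forall c : X, (c != a) && (c != b) ==> (val s c == val t c)]]].

Lemma FS_sym : symmetric FS_rel.
Proof.
suff sub s t : FS_rel s t -> FS_rel t s by move=> s t; apply/idP/idP; apply: sub.
case/existsP=> a /existsP[b /and5P[eab es /eqP sa /eqP sb /forallP sc]].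
apply/existsP; exists a; apply/existsP; exists b.
rewrite eab -sa -sb edge_sym es !eqxx /=.
by apply/forallP=> c; rewrite [X in _ ==> X]eq_sym; apply: sc.
Qed.
Lemma FS_irrefl : irreflexive FS_rel.
Proof.
move=> s; apply/negbTE/negP => /existsP[a /existsP[b /and5P[_ es /eqP sa _ _]]].
by rewrite sa edge_irrefl in es.
Qed.

Definition FS : sgraph := SGraph FS_sym FS_irrefl.

End FriendsAndStrangers.

(* Main.v *)
(* The vertices of FS(K_{k,n-k}, Y) are placements on Y of k left and n - k
   right tokens, and a move exchanges a left and a right token on adjacent
   vertices. In each case a quantity is invariant under all moves but not
   constant:
   - Y disconnected: the component of Y holding a given token;
   - Y bipartite: the sign of the placement plus the number of left tokens on
     one colour class, modulo 2;
   - Y with a non-trivial k-bridge: read left tokens as holes. A right token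
     cannot be carried from beyond one end of the bridge to beyond the other,
     because there are not enough holes;
   - Y = C_n with n > 4: the cyclic order of three right tokens, which exist
     since n - k > 2. For n = 4 the cycle is bipartite. *)
Require Import Defs.
From HB Require Import structures.
From mathcomp Require Import all_boot.
From mathcomp Require Import fingroup perm zify.

Set Implicit Arguments.
Unset Strict Implicit.
Unset Printing Implicit Defensive.

Lemma inj_of_card (S T : finType) : #|S| = #|T| -> exists f : S -> T, injective f.
Proof.
move=> cardST; exists (fun x => enum_val (cast_ord cardST (enum_rank x))) => x y.
by move=> /enum_val_inj/cast_ord_inj/enum_rank_inj.
Qed.

(** * Placements of tokens and their rearrangements *)

Section Bijections.
Variables X Y : sgraph.

Lemma bijection_inj (s : bijection X Y) : injective (val s).
Proof. by case: s => f /= /andP[/injectiveP]. Qed.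

Hypothesis cardXY : #|X| = #|Y|.

Lemma exists_bijection (f : X -> Y) :
  injective f -> exists s : bijection X Y, val s =1 f.
Proof.
move=> f_inj.
suff bf : bijectiveb (finfun f) by exists (exist _ (finfun f) bf) => x; rewrite ffunE.
apply/andP; split; first by apply/injectiveP => x y; rewrite !ffunE => /f_inj.
apply/forallP => y.
have /codomP[x ->] : y \in codom f by apply: inj_card_onto f_inj _ y; rewrite cardXY.
by apply/existsP; exists x; rewrite ffunE.
Qed.

Lemma exists_bijection_swap (s : bijection X Y) (u v : X) :
  exists t : bijection X Y, forall x, val t x = val s (tperm u v x).
Proof. by apply: exists_bijection; apply: inj_comp (@bijection_inj s) perm_inj. Qed.

Lemma exists_bijection2 (x1 x2 : X) (y1 y2 : Y) :
  x1 != x2 -> y1 != y2 ->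
  exists s : bijection X Y, val s x1 = y1 /\ val s x2 = y2.
Proof.
move=> neqx neqy.
have [f0 f0_inj] := inj_of_card cardXY.
(* This transposition brings [x1] to [y1]; the later one, which corrects [x2], moves only [f1 x2]
   and [y2], both different from [y1]. *)
pose f1 x := tperm (f0 x1) y1 (f0 x).
have f1_inj : injective f1 := inj_comp perm_inj f0_inj.
have f1x1 : f1 x1 = y1 by rewrite /f1 tpermL.
have [|s sE] := @exists_bijection (tperm (f1 x2) y2 \o f1).
  exact: inj_comp perm_inj f1_inj.
exists s; rewrite !sE /= tpermL f1x1 tpermD // 1?eq_sym //.
by rewrite -f1x1 (inj_eq f1_inj).
Qed.

End Bijections.

(** * Invariants of moves *)

Lemma FS_invariant (X Y : sgraph) (T : eqType) (phi : bijection X Y -> T) :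
  (forall s t, FS_rel s t -> phi s = phi t) ->
  connected (FS X Y) -> forall s t, phi s = phi t.
Proof.
move=> phi_inv conn s t.
have cl : closed (@edge (FS X Y)) [pred u | phi u == phi t].
  by move=> u v /phi_inv; rewrite !inE => ->.
by have := closed_connect cl (conn s t); rewrite !inE eqxx => /eqP.
Qed.

Lemma FS_relP (X Y : sgraph) (s t : bijection X Y) :
  FS_rel s t ->
  exists a b : X, [/\ edge a b, edge (val s a) (val s b)
    & forall c, val t c = val s (tperm a b c)].
Proof.
case/existsP=> a /existsP[b /and5P[eab es /eqP sa /eqP sb /forallP sc]].
exists a, b; split=> // c.
case: tpermP => [->|->|/eqP ca /eqP cb] //.
by have := sc c; rewrite ca cb => /eqP.
Qed.

Lemma FS_disconnected (X Y : sgraph) (x1 x2 : X) :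
  #|X| = #|Y| -> x1 != x2 -> connected (FS X Y) -> connected Y.
Proof.
move=> cardXY neqx conn x y.
have [-> //|neqxy] := eqVneq x y.
have [s [sx _]] := exists_bijection2 cardXY neqx neqxy.
have [|t [ty _]] := @exists_bijection2 _ _ cardXY x1 x2 y x neqx.
  by rewrite eq_sym.
have sym := sym_connect_sym (@edge_sym Y).
pose phi (u : bijection X Y) := connect (@edge Y) (val u x1) x.
have phi_inv u v : FS_rel u v -> phi u = phi v.
  move=> /FS_relP[a [b [_ euv vE]]]; rewrite /phi vE; apply: (same_connect sym).
  case: tpermP => [->|->|] //; first exact: connect1.
  by apply: connect1; rewrite edge_sym.
by have := FS_invariant phi_inv conn s t; rewrite /phi sx ty connect0 sym.
Qed.

(** * Exchanges of left and right tokens *)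

Section TwoTypes.
Variables (p q : nat) (Y : sgraph).
Let X := complete_bipartite p q.
Hypothesis cardXY : #|X| = #|Y|.
Implicit Types s t : bijection X Y.

Lemma FS_Kpq_relP s t :
  FS_rel s t ->
  exists (i : 'I_p) (j : 'I_q), edge (val s (inl i)) (val s (inr j)) /\
    forall c, val t c = val s (tperm (inl i : X) (inr j) c).
Proof.
case/FS_relP=> -[i|i] [[j|j] [//= _ est tE]]; first by exists i, j.
exists j, i; split=> [|c]; first by rewrite edge_sym.
by rewrite tE tpermC.
Qed.

(** A move is a transposition and takes one left token to the other colour class, so both summands
    of [phi] flip. Exchanging two right tokens flips the sign alone. *)
Lemma FS_Kpq_bipartite : 1 < q -> bipartite Y -> ~ connected (FS X Y).
Proof.
move=> q_gt1 [c cP] conn.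
have [f f_inj] := inj_of_card cardXY.
pose j1 : X := inr (Ordinal (ltnW q_gt1)); pose j2 : X := inr (Ordinal q_gt1).
(* A sign needs a permutation, so [Y] is identified with [X] through a fixed injection. *)
have [g g_inj] := inj_of_card (esym cardXY).
pose gs s : {perm X} := perm (inj_comp g_inj (@bijection_inj _ _ s)).
have gsE s t u v : (forall x, val t x = val s (tperm u v x)) ->
  gs t = (tperm u v * gs s)%g.
  by move=> tE; apply/permP => x; rewrite permM [LHS]permE [RHS]permE /= tE.
pose phi s := gs s (+) \big[addb/false]_i c (val s (inl i)).
have phi_inv s t : FS_rel s t -> phi s = phi t.
  move=> /FS_Kpq_relP[i [j [est tE]]]; rewrite /phi (gsE _ _ _ _ tE).
  rewrite odd_mul_tperm (bigD1 i) //= [in RHS](bigD1 i) //= tE tpermL.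
  rewrite [in RHS](eq_bigr (fun i => c (val s (inl i)))); last first.
    by move=> i' ne; rewrite tE tpermD // eq_sym.
  by have := cP _ _ est; case: (c _); case: (c _) => // _;
     case: (odd_perm _); case: (\big[_/_]_(_ | _) _).
have [s _] := exists_bijection cardXY f_inj.
have [t tE] := exists_bijection_swap cardXY s j1 j2.
have := FS_invariant phi_inv conn s t; rewrite /phi (gsE _ _ _ _ tE) odd_mul_tperm.
rewrite [in RHS](eq_bigr (fun i => c (val s (inl i)))) => [|i _]; last first.
  by rewrite tE tpermD.
by case: (odd_perm _); case: (\big[_/_]_(_ | _) _).
Qed.

(* Levels 1, ..., p are the vertices of the bridge, level 0 and level p + 1 the
   vertices beyond its two ends. A right token at level l is on the side of
   level 0 when at least l holes lie strictly below it: always for l = 0, never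
   for l = p + 1, and no move changes it since a level in 1, ..., p holds only
   one token. *)
Lemma FS_Kpq_levels (P : Y -> nat) (y1 y2 : Y) :
  1 < q ->
  (forall y, P y <= p.+1) ->
  (forall x y, 0 < P x <= p -> P x = P y -> x = y) ->
  (forall x y, edge x y -> P x <= (P y).+1) ->
  P y1 = 0 -> P y2 = p.+1 -> ~ connected (FS X Y).
Proof.
move=> q_gt1 P_le P_inj P_edge Py1 Py2 conn.
pose j1 : 'I_q := Ordinal (ltnW q_gt1); pose j2 : 'I_q := Ordinal q_gt1.
pose low s z := \sum_i (P (val s (inl i)) < z).
have low_le s z : low s z <= p.
  by rewrite -[leqRHS]card_ord -sum1_card; apply: leq_sum => i _; apply: leq_b1.
pose left s := P (val s (inr j1)) <= low s (P (val s (inr j1))).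
have left_inv s t : FS_rel s t -> left s = left t.
  move=> /FS_Kpq_relP[i [j [est tE]]]; rewrite /left.
  set x := val s (inl i) in est; set y := val s (inr j) in est.
  have est' : edge y x by rewrite edge_sym.
  have := (P_edge _ _ est, P_edge _ _ est') => -[dxy dyx].
  (* The holes other than [i] stay put, so [low s] and [low t] differ only in the term of [i]. *)
  pose C z := \sum_(i' | i' != i) (P (val s (inl i')) < z).
  have lowsE z : low s z = (P x < z) + C z by rewrite /low (bigD1 i).
  have lowtE z : low t z = (P y < z) + C z.
    rewrite /low (bigD1 i) //= tE tpermL; congr (_ + _).
    by apply: eq_bigr => i' ne; rewrite tE tpermD // eq_sym.
  (* A bridge level containing [x] or [y] holds no other vertex, hence none of the holes counted by
     [C]. *)
  have C_step w : (w == x) || (w == y) -> 0 < P w <= p -> C (P w).+1 = C (P w).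
    move=> wxy Pw; apply: eq_bigr => i' ne; rewrite ltnS leq_eqVlt.
    have [e|//] := eqVneq (P (val s (inl i'))) (P w).
    have ew := P_inj _ _ Pw (esym e); move: wxy; rewrite ew.
    by rewrite !(inj_eq (@bijection_inj _ _ s)) orbF => /eqP[ei]; rewrite ei eqxx in ne.
  have C_max : (P x < p.+1) + C p.+1 <= p by rewrite -lowsE.
  have C_max' : (P y < p.+1) + C p.+1 <= p by rewrite -lowtE.
  have Px := P_le x; have Py := P_le y.
  have Cx := C_step x; have Cy := C_step y; rewrite !eqxx ?orbT in Cx Cy.
  rewrite tE.
  (* If [j1] itself moves between levels [l] and [l + 1], the hole it meets is counted exactly when
     [j1] is on the upper one, so threshold and count change together; for [l = 0] both sides are
     true. *)
  have [ej|nej] := eqVneq j j1.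
    rewrite -ej tpermR -/x -/y lowsE lowtE.
    have [lt|lt|eq] := ltngtP (P x) (P y).
    - have e : P y = (P x).+1 by lia.
      by move: Cx C_max C_max'; rewrite e; case: (posnP (P x)) => [->|Px_gt0] => [|->]; lia.
    - have e : P x = (P y).+1 by lia.
      by move: Cy C_max C_max'; rewrite e; case: (posnP (P y)) => [->|Py_gt0] => [|->]; lia.
    - by rewrite eq.
  (* If [j1] rests at [b], the count below its level changes only when [x] or [y] shares that level.
     On levels 1 to [p] this is impossible; on level [p + 1] both sides are false, as there are only
     [p] holes. *)
  rewrite tpermD //.
  set b := val s (inr j1); rewrite lowsE lowtE.
  have bx : b != x by rewrite (inj_eq (@bijection_inj _ _ s)).
  have b_y : b != y by rewrite (inj_eq (@bijection_inj _ _ s)) eq_sym.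
  have Pbx : 0 < P b <= p -> P b <> P x by move=> Pb /(P_inj _ _ Pb)/eqP; apply/negP.
  have Pby : 0 < P b <= p -> P b <> P y by move=> Pb /(P_inj _ _ Pb)/eqP; apply/negP.
  have Pb := P_le b.
  have [Pb_top|Pb_top] := eqVneq (P b) p.+1; first by rewrite Pb_top; lia.
  by case: (posnP (P b)) => [->|Pb_gt0] //; lia.
have neqj : inr j1 != inr j2 :> X by [].
have neqy : y1 != y2 by apply: contra_eqN Py2 => /eqP <-; rewrite Py1.
have [s [s1 s2]] := exists_bijection2 cardXY neqj neqy.
have [t tE] := exists_bijection_swap cardXY s (inr j1) (inr j2).
have := FS_invariant left_inv conn s t.
by rewrite /left tE tpermL s1 s2 Py1 Py2 [RHS]leqNgt ltnS low_le.
Qed.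

(** * Cyclic order of three tokens on a cycle *)

Definition cyclically_ordered (a b c : nat) : bool :=
  [|| a < b < c, b < c < a | c < a < b].

Lemma cyclic_step n a b :
  (a.+1 %% n == b) || (b.+1 %% n == a) -> a < n -> b < n ->
  [|| a.+1 == b, b.+1 == a, (a == 0) && (b.+1 == n) | (b == 0) && (a.+1 == n)].
Proof.
have mod_succ c : c < n -> c.+1 %% n = if c.+1 == n then 0 else c.+1.
  by rewrite leq_eqVlt; case: eqP => [-> _|_ /modn_small //]; rewrite modnn.
by move=> + an bn; rewrite !mod_succ //; case: (eqVneq a.+1 n) => ?; case: (eqVneq b.+1 n) => ?; lia.
Qed.

(** A right token steps from [v] to the hole at [u]. No position lies strictly between these
    neighbours and none of the three tokens is at [u], so no token is overtaken. *)
Lemma cyclically_ordered_step (n u v a b c : nat) :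
  (u.+1 %% n == v) || (v.+1 %% n == u) -> u < n -> v < n ->
  a < n -> b < n -> c < n -> u != a -> u != b -> u != c ->
  a != b -> a != c -> b != c ->
  cyclically_ordered a b c = cyclically_ordered (if a == v then u else a)
    (if b == v then u else b) (if c == v then u else c).
Proof.
move=> uv un vn; rewrite /cyclically_ordered; move: (@cyclic_step _ _ _ uv un vn).
move=> {}uv an bn cn ua ub uc ab ac bc.
have {}uv : [\/ v = u.+1, u = v.+1, u = 0 /\ v.+1 = n | v = 0 /\ u.+1 = n].
  by case/or4P: uv => [/eqP|/eqP|/andP[/eqP ? /eqP]|/andP[/eqP ? /eqP]];
    [constructor 1|constructor 2|constructor 3|constructor 4].
case: (eqVneq a v) => [?|av]; first subst a.
  rewrite eq_sym (negbTE ab) eq_sym (negbTE ac).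
  by case: uv => [?|?|[? ?]|[? ?]]; subst; lia.
case: (eqVneq b v) => [?|bv] /=; first subst b.
  rewrite eq_sym (negbTE bc).
  by case: uv => [?|?|[? ?]|[? ?]]; subst; lia.
case: (eqVneq c v) => [?|cv] //; subst c.
by case: uv => [?|?|[? ?]|[? ?]]; subst; lia.
Qed.

Lemma FS_Kpq_cycle (f : Y -> 'I_#|Y|) :
  2 < q -> injective f -> (forall x y, edge x y -> cycle_rel (f x) (f y)) ->
  ~ connected (FS X Y).
Proof.
move=> q_gt2 f_inj f_edge conn.
pose j1 : X := inr (Ordinal (ltnW (ltnW q_gt2))); pose j2 : X := inr (Ordinal (ltnW q_gt2)).
pose j3 : X := inr (Ordinal q_gt2).
pose pos s j : nat := f (val s j).
have pos_inj s : injective (pos s) by move=> x y /ord_inj/f_inj/bijection_inj.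
have pos_neq s u v : u != v -> pos s u != pos s v by rewrite (inj_eq (@pos_inj s)).
pose phi s := cyclically_ordered (pos s j1) (pos s j2) (pos s j3).
have phi_inv s t : FS_rel s t -> phi s = phi t.
  move=> /FS_Kpq_relP[i [j [/f_edge /andP[_ est] tE]]].
  have tposE w : pos t (inr w) =
      if pos s (inr w) == pos s (inr j) then pos s (inl i) else pos s (inr w).
    rewrite (inj_eq (@pos_inj s)) /pos tE.
    by case: eqVneq => [->|ne]; rewrite ?tpermR // tpermD // eq_sym.
  rewrite /phi !tposE; apply: cyclically_ordered_step est _ _ _ _ _ _ _ _ _ _ _;
    by [apply: ltn_ord | apply: pos_neq].
have [f0 f0_inj] := inj_of_card cardXY.
have [s _] := exists_bijection cardXY f0_inj.
(* Exchanging two of three distinct positions reverses their cyclic order. *)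
have [t tE] := exists_bijection_swap cardXY s j1 j2.
have := FS_invariant phi_inv conn s t; rewrite /phi /pos !tE tpermL tpermR tpermD // -!/(pos s _).
move: (pos_neq s j1 j2 isT) (pos_neq s j1 j3 isT) (pos_neq s j2 j3 isT).
by rewrite /cyclically_ordered; lia.
Qed.

End TwoTypes.

(** * Levels on a subdivided cut edge *)

Lemma subdivision_levels (H : sgraph) (a b : H) (k : nat) :
  1 < k -> connected H -> nontrivial_cut_edge a b ->
  exists P : subdivide a b (k - 2) -> nat,
  [/\ forall y, P y <= k.+1,
      forall x y, 0 < P x <= k -> P x = P y -> x = y,
      forall x y, edge x y -> P x <= (P y).+1,
      exists y, P y = 0 & exists y, P y = k.+1].
Proof.
move=> k_gt1 connH [[eab discon] da db].
pose D := @edge (del_edge a b); pose L := connect D a.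
have symD : connect_sym D := sym_connect_sym (@edge_sym (del_edge a b)).
have La : L a by exact: connect0.
(* Otherwise each use of the edge [ab] in a walk could be bypassed, and deleting it would leave [H]
   connected. *)
have Lb : ~~ L b.
  apply/negP => Lb; apply: discon => x y.
  apply: connect_sub (connH x y) => u v euv.
  have [e|ne] := eqVneq [set u; v] [set a; b]; last by apply: connect1; apply/andP.
  have : u != v by apply: contraTneq euv => ->; rewrite edge_irrefl.
  have : u \in [set a; b] by rewrite -e !inE eqxx.
  have : v \in [set a; b] by rewrite -e !inE eqxx orbT.
  by rewrite !inE => /orP[]/eqP-> /orP[]/eqP->; rewrite ?eqxx // => _; rewrite // symD.
have L_D x y : D x y -> L x = L y.
  by move=> xy; rewrite /L !(symD a); apply: (same_connect symD); apply: connect1.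
(* The levels required by [FS_Kpq_levels] with [p = k]: [a] is 1, the new vertices are 2 to [k - 1],
   [b] is [k], and the rest of the two sides gets 0 and [k + 1]. *)
pose P (u : subdivide a b (k - 2)) := match u with
  | inl x => if L x then (x == a : nat) else if x == b then k else k.+1
  | inr i => i.+2
  end.
(* Non-triviality enters here: second neighbours of [a] and [b] witness the outermost levels. *)
have neighbour (u v : H) : edge u v -> degree u <> 1 -> exists2 w, edge u w & w != v.
  move=> euv du; have /set0Pn[w] : [set y | edge u y] :\ v != set0.
    rewrite -cards_eq0; apply: contra_not_neq du => du.
    by rewrite /degree (cardsD1 v) du inE euv.
  by rewrite !inE => /andP[? ?]; exists w.
have [a' eaa' na'] := neighbour _ _ eab da.
have [b' ebb' nb'] := neighbour _ _ (etrans (edge_sym b a) eab) db.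
have irr (x y : H) : edge x y -> y != x by apply: contraTneq => ->; rewrite edge_irrefl.
have Da' : D a a'.
  apply/andP; split=> //; apply: contraNneq na' => e.
  have : a' \in [set a; b] by rewrite -e !inE eqxx orbT.
  by rewrite !inE (negbTE (irr _ _ eaa')).
have Db' : D b b'.
  apply/andP; split=> //; apply: contraNneq nb' => e.
  have : b' \in [set a; b] by rewrite -e !inE eqxx orbT.
  by rewrite !inE (negbTE (irr _ _ ebb')) orbF.
(* Such an edge stays on one side, where only two consecutive levels occur. *)
have P_D x y : D x y -> P (inl x) <= (P (inl y)).+1.
  move=> /L_D /= ->; case: (L y); first by case: (x == a).
  by case: (x == b); case: (y == b); rewrite ?ltnS ?leqW.
exists P; split.
- case=> [x|i] /=; last by have := ltn_ord i; clear; lia.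
  by case: (L x); [case: (x == a) | case: (x == b)].
- move=> [x|i] [y|j] /=; rewrite ?eqSS.
  + case Lx: (L x); case Ly: (L y).
    * by case: (eqVneq x a) => [-> _|_ //]; case: (eqVneq y a) => [->|].
    * by case: (x == a) => // _; case: (y == b) => e; exfalso; clear -e k_gt1; lia.
    * by case: (y == a); case: (x == b) => Px e; exfalso; clear -Px e k_gt1; lia.
    * case: (eqVneq x b) => [-> _|_ Px]; last by exfalso; clear -Px; lia.
      by case: (eqVneq y b) => [->|_ e] //; exfalso; clear -e; lia.
  + by have := ltn_ord j; case: (L x); case: (_ == _) => jk Px e; exfalso; clear -jk Px e; lia.
  + by have := ltn_ord i; case: (L y); case: (_ == _) => ik Px e; exfalso; clear -ik Px e; lia.
  + by move=> _ [/ord_inj ->].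
- have Pa : P (inl a) = 1 by rewrite /= La eqxx.
  have Pb : P (inl b) = k by rewrite /= (negbTE Lb) eqxx.
  move=> [x|i] [y|j].
  + move=> exy; have {exy}: if k - 2 == 0 then edge x y else D x y := exy.
    (* For [k = 2] the edge [ab] itself survives and joins levels 1 and 2. *)
    case: eqVneq => [k2|_]; last exact: P_D.
    move=> exy; have [e|ne] := eqVneq [set x; y] [set a; b]; last first.
      by apply: P_D; apply/andP.
    have : x \in [set a; b] by rewrite -e !inE eqxx.
    have : y \in [set a; b] by rewrite -e !inE eqxx orbT.
    by rewrite !inE => /orP[]/eqP-> /orP[]/eqP->; rewrite ?Pa ?Pb; clear -k2; lia.
  + by move=> /orP[]/andP[/eqP-> /eqP ej]; rewrite ?Pa ?Pb /=; clear -ej; lia.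
  + by move=> /orP[]/andP[/eqP-> /eqP ei]; rewrite ?Pa ?Pb /=; clear -ei; lia.
  + by move=> /= /orP[]/eqP; clear; lia.
- by exists (inl a'); rewrite /= -(L_D _ _ Da') La (negbTE (irr _ _ eaa')).
- by exists (inl b'); rewrite /= -(L_D _ _ Db') (negbTE Lb) (negbTE (irr _ _ ebb')).
Qed.

Theorem theorem1p3 (n k : nat) (Y : sgraph) :
  4 <= 2 * k -> 2 * k <= n -> #|Y| = n ->
  [\/ ~ connected Y, bipartite Y, has_nontrivial_bridge k Y
    | isomorphic Y (cycle_graph n)] ->
  ~ connected (FS (complete_bipartite k (n - k)) Y).
Proof.
move=> k_ge2 n_ge2k cardY.
have cardX : #|complete_bipartite k (n - k)| = #|Y|.
  by rewrite card_sum !card_ord cardY; lia.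
have q_gt1 : 1 < n - k by lia.
case=> [discon|bip|[H [a [b [connH cut [f [g fK gK] fE]]]]]|[f f_bij fE]].
- move=> /(FS_disconnected cardX) conn; apply: discon.
  by apply: (conn (inr (Ordinal (ltnW q_gt1))) (inr (Ordinal q_gt1))).
- exact: FS_Kpq_bipartite.
- have k_gt1 : 1 < k by lia.
  have [P [P_le P_inj P_edge [u1 Pu1] [u2 Pu2]]] := subdivision_levels k_gt1 connH cut.
  apply: (@FS_Kpq_levels _ _ _ cardX (P \o f) (g u1) (g u2)) => //=; rewrite ?gK //.
  + by move=> x y Px /(P_inj _ _ Px)/(can_inj fK).
  + by move=> x y; rewrite -fE => /P_edge.
(* For [n = 4] there are only two right tokens, too few for a cyclic order; the parity of the
   position is then a 2-colouring. *)
- have [n4|n_gt4] := leqP n 4.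
    have n_eq : n = 4 by lia.
    apply: FS_Kpq_bipartite => //; exists (fun y => odd (f y)) => x y; rewrite -fE.
    move=> /andP[_]; move: (f x) (f y); rewrite n_eq.
    by do 2 case=> [[|[|[|[|?]]]] ?].
  have q_gt2 : 2 < n - k by lia.
  subst n; apply: (FS_Kpq_cycle cardX q_gt2 (bij_inj f_bij)) => x y.
  by rewrite -fE.
Qed.
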